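(* Assume that $\mathcal{S}_{(S,j)}$ satisfies the Reversed Fatou Property (RFP) for each $S\in\mathcal{S}$ and each $j\ge 0$, and that every node $(S,j)$ is either an arbitrage free node or an arbitrage node of type I. Then property $(L_{(S,j)})$ holds at each node $(S,j)$; that is, for all $S\in\mathcal{S}$, $j\ge 0$, $f\in\mathcal{E}_{(S,j)}$ and $f_m\in\mathcal{D}^+_{(S,j)}$ $(m\ge 1)$: if $f\le\sum_{m\ge1}f_m$ on $\mathcal{S}_{(S,j)}$, then $I_jf(S)\le\sum_{m\ge1}I_jf_m(S)$.
   Context: Setting. Fix $s_0\in\mathbb{R}$ and a trajectory set $\mathcal{S}$, i.e. a (nonempty) set of real sequences $S=(S_i)_{i\ge0}$ with $S_0=s_0$. For $S\in\mathcal{S}$ and $j\ge0$ let $\mathcal{S}_{(S,j)}=\{\tilde S\in\mathcal{S}:\tilde S_i=S_i,\ 0\le i\le j\}$; the pair $(S,j)$ is called a node. Put $\Delta_iS=S_{i+1}-S_i$. For every node a set $\mathcal{H}_{(S,j)}$ of portfolios is given (depending only on the node, i.e. $\mathcal H_{(\tilde S,j)}=\mathcal H_{(S,j)}$ if $\tilde S\in\mathcal S_{(S,j)}$): its elements are sequences $H=(H_i)_{i\ge j}$ of functions $H_i:\mathcal{S}_{(S,j)}\to\mathbb{R}$ that are non-anticipative, i.e. $H_i(\tilde S)=H_i(\hat S)$ whenever $\tilde S_k=\hat S_k$ for $j\le k\le i$. The following is assumed: (H.1) $\alpha\mathcal{H}_{(S,j)}+\mathcal{H}_{(S,j)}\subseteq\mathcal{H}_{(S,j)}$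 for all $\alpha\ge0$; (H.2) every $(H_i)_{i\ge j}$ with each $H_i$ constant on $\mathcal{S}_{(S,j)}$ with value $-1$, $0$ or $1$ belongs to $\mathcal{H}_{(S,j)}$; (H.3) if $(H_i)_{i\ge j}\in\mathcal{H}_{(S,j)}$ and $k\ge j$ then $(H_i|_{\mathcal{S}_{(S,k)}})_{i\ge k}\in\mathcal{H}_{(S,k)}$; (H.4) if $(H_i)_{i\ge j}\in\mathcal{H}_{(S,j)}$, $k\ge j$, $G_i=H_i$ for $j\le i\le k$ and $G_i=0$ for $i>k$, then $G\in\mathcal{H}_{(S,j)}$. Elementary functions. For $V\in\mathbb{R}$, $H\in\mathcal{H}_{(S,j)}$, $n\ge j$ let $\Pi^{V,H}_{j,n}(\tilde S)=V+\sum_{i=j}^{n-1}H_i(\tilde S)\Delta_i\tilde S$ for $\tilde S\in\mathcal{S}_{(S,j)}$; $\mathcal{D}_{(S,j)}$ is the set of all such functions, $\mathcal{D}_{(S,j)}^+$ the set of its non-negative elements, and $\mathcal{E}_{(S,j)}=\mathcal{D}_{(S,j)}^+-\mathcal{D}_{(S,j)}^+$. For $f=\Pi^{V,H}_{j,n}\in\mathcal{D}_{(S,j)}^+$ put $I_jf(S)=V$, and for $f=f_1-f_2$ with $f_1,f_2\in\mathcal{D}^+_{(S,j)}$ put $I_jf(S)=I_jf_1(S)-I_jf_2(S)$. (This is well defined when $\mathcal{S}$ is locally $0$-neutral, i.e. when $\sup_{\tilde S\in\mathcal{S}_{(S,j)}}(\tilde S_{j+1}-S_j)\ge0\ge\inf_{\tilde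 S\in\mathcal{S}_{(S,j)}}(\tilde S_{j+1}-S_j)$ at every node, which is the case under the hypotheses of the claim.) Node types. A node $(S,j)$ is up-down if $\sup_{\tilde S\in\mathcal{S}_{(S,j)}}(\tilde S_{j+1}-S_j)>0$ and $\inf_{\tilde S\in\mathcal{S}_{(S,j)}}(\tilde S_{j+1}-S_j)<0$; flat if both the supremum and the infimum are $0$; arbitrage free if it is up-down or flat; otherwise it is an arbitrage node. An arbitrage node is of type I if there is $\hat S\in\mathcal{S}_{(S,j)}$ with $\hat S_{j+1}=S_j$, otherwise of type II. Limits and RFP. If $\{S^n\}_{n\ge0}\subseteq\mathcal{S}_{(S,j)}$ satisfies $S^n_i=S^{n+1}_i$ for $0\le i\le n$ and all $n$, define $\overline S=\lim_{n\to\infty}S^n$ by $\overline S_i=S^i_i$. $\overline{\mathcal{S}_{(S,j)}}$ is the set of all such $\overline S$. $\mathcal{S}_{(S,j)}$ satisfies the Reversed Fatou Property (RFP) if for any $f_0\in\mathcal{E}_{(S,j)}$ and $f_m=\Pi^{V^m,H^m}_{j,n_m}\in\mathcal{D}_{(S,j)}^+$ $(m\ge1)$ with $\sum_{m\ge1}V^m<\infty$, and any $\overline S\in\overline{\mathcal{S}_{(S,j)}}$, there is at least one sequence $\{S^n\}_{n\ge0}\subseteq\mathcal{S}_{(S,j)}$ with $\overline S=\lim_{n\to\infty}S^n$ (i.e. $S^n_i=S^{n+1}_i$ for $0\le i\le n$ and all $n\ge0$, and $\overline S_i=S^i_i$ for all $i\ge0$) and $\sum_{m\ge0}\limsup_{n\to\infty}f_m(S^n)\ge\limsup_{n\to\infty}\sum_{m\ge0}f_m(S^n)$.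 *)

(* Defs.v *)
From mathcomp Require Import all_boot all_order all_algebra.
From mathcomp Require Import all_classical all_reals all_analysis.
From mathcomp Require Import lra.

Set Implicit Arguments.
Unset Strict Implicit.
Unset Printing Implicit Defensive.

Import Order.TTheory GRing.Theory Num.Theory.
Import numFieldNormedType.Exports.

Local Open Scope classical_set_scope.
Local Open Scope ring_scope.

(* A price trajectory is a real sequence [S : nat -> R]. *)

Definition is_trajectory_set (R : realType) (s0 : R) (TS : set (nat -> R)) :=
  TS !=set0 /\ forall S, TS S -> S 0%N = s0.

(* The set of trajectories of the node [(S, j)]. *)
Definition node (R : realType) (TS : set (nat -> R)) (S : nat -> R) (j : nat) :
    set (nat -> R) :=
  [set T | TS T /\ forall i, (i <= j)%N -> T i = S i].

(* A portfolio [(H_i)_{i >= j}] at [(S, j)] consists of functions on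
   [node TS S j] only; it is encoded by a total [H : nat -> (nat -> R) -> R].
   Two encodings stand for the same portfolio when they are related by
   [same_portfolio], and [pf_ext] below makes a set of encodings a set of
   portfolios. *)
Definition same_portfolio (R : realType) (TS : set (nat -> R))
    (S : nat -> R) (j : nat) (H K : nat -> (nat -> R) -> R) :=
  forall i T, (j <= i)%N -> node TS S j T -> H i T = K i T.

Definition nonanticipative (R : realType) (TS : set (nat -> R))
    (S : nat -> R) (j : nat) (H : nat -> (nat -> R) -> R) :=
  forall i T U, (j <= i)%N -> node TS S j T -> node TS S j U ->
    (forall k, (j <= k <= i)%N -> T k = U k) -> H i T = H i U.

(* [PF S j] is the set of portfolios at the node [(S, j)]. Restriction to a
   later node [(S, k)] does not change the encoding. *)
Record portfolio_sets (R : realType) (TS : set (nat -> R))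
    (PF : (nat -> R) -> nat -> set (nat -> (nat -> R) -> R)) : Prop := {
  pf_ext : forall S j H K, TS S -> PF S j H ->
    same_portfolio TS S j H K -> PF S j K;
  pf_node : forall S T j, TS S -> node TS S j T -> PF T j = PF S j;
  pf_nonanticipative : forall S j H, TS S -> PF S j H ->
    nonanticipative TS S j H;
  pf_cone : forall S j H K (a : R), TS S -> 0 <= a -> PF S j H -> PF S j K ->
    PF S j (fun i T => a * H i T + K i T);
  pf_const : forall S j (c : nat -> R), TS S ->
    (forall i, (j <= i)%N -> [\/ c i = -1, c i = 0 | c i = 1]) ->
    PF S j (fun i _ => c i);
  pf_restrict : forall S j k H, TS S -> (j <= k)%N -> PF S j H -> PF S k H;
  pf_stop : forall S j k H, TS S -> (j <= k)%N -> PF S j H ->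
    PF S j (fun i T => if (i <= k)%N then H i T else 0) }.

Definition wealth (R : realType) (j : nat) (V : R)
    (H : nat -> (nat -> R) -> R) (n : nat) (T : nat -> R) : R :=
  V + \sum_(j <= i < n) H i T * (T i.+1 - T i).

Section Elementary.
Context (R : realType) (TS : set (nat -> R)).
Context (PF : (nat -> R) -> nat -> set (nat -> (nat -> R) -> R)).

(* [f] and [wealth j V H n] coincide as functions on the node; the values of
   the total function [f] off the node play no role. *)
Definition represents (S : nat -> R) (j : nat) (V : R)
    (H : nat -> (nat -> R) -> R) (n : nat) (f : (nat -> R) -> R) :=
  [/\ PF S j H, (j <= n)%N &
      forall T, node TS S j T -> f T = wealth j V H n T].

Definition elementary S j (f : (nat -> R) -> R) :=
  exists V H n, represents S j V H n f.

Definition elementary_pos S j (f : (nat -> R) -> R) :=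
  elementary S j f /\ forall T, node TS S j T -> 0 <= f T.

Definition elementary_diff S j (f : (nat -> R) -> R) :=
  exists f1 f2, [/\ elementary_pos S j f1, elementary_pos S j f2 &
    forall T, node TS S j T -> f T = f1 T - f2 T].

(* The possible values [V1 - V2] of the price of [f] at [(S, j)], one for each
   way of writing [f] as a difference of non-negative elementary functions. *)
Definition price_values S j (f : (nat -> R) -> R) : set R :=
  [set v | exists V1 H1 n1 f1 V2 H2 n2 f2,
    [/\ represents S j V1 H1 n1 f1 /\ (forall T, node TS S j T -> 0 <= f1 T),
        represents S j V2 H2 n2 f2 /\ (forall T, node TS S j T -> 0 <= f2 T),
        forall T, node TS S j T -> f T = f1 T - f2 T &
        v = V1 - V2]].

(* [price S j f] is the number I_j f (S). When the trajectory set is locally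
   0-neutral, [price_values S j f] has at most one element and [price] is
   determined by the representations of [f]: see [price_diffE] and
   [price_posE]. *)
Definition price S j (f : (nat -> R) -> R) : R := xget 0 (price_values S j f).

End Elementary.

Section NodeTypes.
Context (R : realType) (TS : set (nat -> R)).
Local Open Scope ereal_scope.

Definition moves (S : nat -> R) (j : nat) : set (\bar R) :=
  [set (T j.+1 - S j)%:E | T in node TS S j].

Definition neutral_node S j :=
  0 <= ereal_sup (moves S j) /\ ereal_inf (moves S j) <= 0.

Definition locally_neutral := forall S j, TS S -> neutral_node S j.

Definition up_down_node S j :=
  0 < ereal_sup (moves S j) /\ ereal_inf (moves S j) < 0.

Definition flat_node S j :=
  ereal_sup (moves S j) = 0 /\ ereal_inf (moves S j) = 0.

Definition arbitrage_free_node S j := up_down_node S j \/ flat_node S j.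

Definition arbitrage_node S j := ~ arbitrage_free_node S j.

Definition arbitrage_node_typeI S j :=
  arbitrage_node S j /\ exists T, node TS S j T /\ T j.+1 = S j.

End NodeTypes.

Section Fatou.
Context (R : realType) (TS : set (nat -> R)).
Context (PF : (nat -> R) -> nat -> set (nat -> (nat -> R) -> R)).

Definition trajectory_limit S j (Sn : nat -> nat -> R) (Sbar : nat -> R) :=
  [/\ forall n, node TS S j (Sn n),
      forall n i, (i <= n)%N -> Sn n i = Sn n.+1 i &
      forall i, Sbar i = Sn i i].

Definition node_closure S j : set (nat -> R) :=
  [set Sbar | exists Sn, trajectory_limit S j Sn Sbar].

(* [f 0] is the signed function; [V 0], [H 0] and [N 0] are not used. *)
Definition reversed_fatou S j :=
  forall (f : nat -> (nat -> R) -> R) (V : nat -> R)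
      (H : nat -> nat -> (nat -> R) -> R) (N : nat -> nat) (Sbar : nat -> R),
    elementary_diff TS PF S j (f 0%N) ->
    (forall m, (1 <= m)%N ->
      represents TS PF S j (V m) (H m) (N m) (f m) /\
      forall T, node TS S j T -> 0 <= f m T) ->
    (\sum_(1 <= m <oo) (V m)%:E < +oo)%E ->
    node_closure S j Sbar ->
    exists Sn, trajectory_limit S j Sn Sbar /\
      (limn_esup (fun n => \sum_(0 <= m <oo) (f m (Sn n))%:E) <=
       \sum_(0 <= m <oo) limn_esup (fun n => (f m (Sn n))%:E))%E.

Definition property_L S j :=
  forall (f : (nat -> R) -> R) (fm : nat -> (nat -> R) -> R),
    elementary_diff TS PF S j f ->
    (forall m, (1 <= m)%N -> elementary_pos TS PF S j (fm m)) ->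
    (forall T, node TS S j T ->
      ((f T)%:E <= \sum_(1 <= m <oo) (fm m T)%:E)%E) ->
    ((price TS PF S j f)%:E <= \sum_(1 <= m <oo) (price TS PF S j (fm m))%:E)%E.

End Fatou.

Section WellDefined.
Context (R : realType) (TS : set (nat -> R)).
Context (PF : (nat -> R) -> nat -> set (nat -> (nat -> R) -> R)).

Lemma neutral_arbitrage_free S j :
  arbitrage_free_node TS S j -> neutral_node TS S j.
Proof. by case=> -[H1 H2]; split; rewrite ?H1 ?H2 // ltW. Qed.

Lemma neutral_typeI S j : arbitrage_node_typeI TS S j -> neutral_node TS S j.
Proof.
case=> _ [T [nT TS0]].
have m0 : moves TS S j 0%E by exists T => //; rewrite TS0 subrr.
by split; [exact: ereal_sup_ubound | exact: ereal_inf_lbound].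
Qed.

Lemma node_sub S j k T U : (j <= k)%N -> node TS S j T -> node TS T k U ->
  node TS S j U.
Proof.
move=> jk [_ TS0] [US UT]; split=> // i ij.
by rewrite UT ?TS0// (leq_trans ij).
Qed.

Lemma small_move S j (g e : R) : neutral_node TS S j -> 0 < e ->
  exists2 T, node TS S j T & g * (T j.+1 - S j) <= e.
Proof.
move=> [sup0 inf0] e0.
pose d := e / (`|g| + 1).
have g1 : 0 < `|g| + 1 by rewrite ltr_wpDl.
have d0 : 0 < d by rewrite divr_gt0.
have gd : `|g| * d <= e.
  by rewrite /d mulrCA -[leRHS]mulr1 ler_pM2l// ler_pdivrMr// mul1r lerDl.
have [g0|g0] := leP 0 g.
  have : (ereal_inf (moves TS S j) < d%:E)%E.
    by apply: le_lt_trans inf0 _; rewrite lte_fin.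
  move=> /ereal_inf_lt[_ [T nT <-]]; rewrite lte_fin => Td; exists T => //.
  by apply: le_trans gd; rewrite (ger0_norm g0) ler_wpM2l// ltW.
have : ((- d)%:E < ereal_sup (moves TS S j))%E.
  by apply: lt_le_trans sup0; rewrite lte_fin oppr_lt0.
move=> /ereal_sup_gt[_ [T nT <-]]; rewrite lte_fin => Td; exists T => //.
apply: le_trans gd; rewrite (ltr0_norm g0) mulNr -mulrN.
by rewrite ler_nM2l// ltW.
Qed.

Lemma small_gain S j n (G : nat -> (nat -> R) -> R) (e : R) :
  locally_neutral TS -> TS S -> nonanticipative TS S j G -> (j <= n)%N ->
  0 < e ->
  exists2 T, node TS S j T & \sum_(j <= i < n) G i T * (T i.+1 - T i) <= e.
Proof.
move=> neu SS naG /subnK <-; elim: (n - j)%N e => [|k IH] e e0.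
  by exists S; [split | rewrite add0n big_geq// ltW].
have e20 : 0 < e / 2 by rewrite divr_gt0.
have [T nT HT] := IH _ e20.
have [U nU HU] := small_move (G (k + j)%N T) (neu T (k + j)%N nT.1) e20.
have nU' : node TS S j U by apply: node_sub nT nU; rewrite leq_addl.
exists U => //.
have [_ UT] := nU.
have eG i : (j <= i <= k + j)%N -> G i U = G i T.
  case/andP=> ji ik; apply: naG => // l /andP[_ li].
  by rewrite UT// (leq_trans li).
rewrite addSn big_nat_recr ?leq_addl//= (splitr e) lerD//; last first.
  by rewrite eG ?leq_addl ?leqnn// (UT (k + j)%N).
apply: le_trans HT; rewrite le_eqVlt; apply/orP; left; apply/eqP.
apply: eq_big_nat => i /andP[ji ik].
by rewrite eG ?ji ?(ltnW ik)// !UT// ltnW.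
Qed.

Lemma zero_wealth S j n V (G : nat -> (nat -> R) -> R) :
  locally_neutral TS -> TS S -> nonanticipative TS S j G -> (j <= n)%N ->
  (forall T, node TS S j T -> wealth j V G n T = 0) -> V = 0.
Proof.
move=> neu SS naG jn w0; apply/eqP; rewrite eq_le; apply/andP; split.
  have naN : nonanticipative TS S j (fun i T => - G i T).
    by move=> i T U ji nT nU TU; rewrite (naG i T U).
  apply/ler_addgt0Pr => e e0; rewrite add0r.
  have [T nT] := small_gain neu SS naN jn e0.
  have := w0 T nT; rewrite /wealth => /eqP; rewrite addr_eq0 => /eqP ->.
  by rewrite -sumrN; under eq_bigr do rewrite mulNr.
apply/ler_addgt0Pr => e e0.
have [T nT] := small_gain neu SS naG jn e0.
have := w0 T nT; rewrite /wealth; lra.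
Qed.

Definition stopped (n : nat) (H : nat -> (nat -> R) -> R) :=
  fun i T => if (i < n)%N then H i T else 0.

Lemma wealth_stopped j n N V H T : (j <= n <= N)%N ->
  wealth j V (stopped n H) N T = wealth j V H n T.
Proof.
move=> /andP[jn nN]; rewrite /wealth (big_cat_nat jn nN)/=; congr (_ + _).
rewrite [X in _ + X]big_nat_cond [X in _ + X]big1 ?addr0.
  by apply: eq_big_nat => i /andP[_ iltn]; rewrite /stopped iltn.
by move=> i; rewrite andbT => /andP[ni _]; rewrite /stopped ltnNge ni mul0r.
Qed.

Lemma price_values_unique S j f v w : portfolio_sets TS PF ->
  locally_neutral TS -> TS S ->
  price_values TS PF S j f v -> price_values TS PF S j f w -> v = w.
Proof.
move=> pf neu SS.
move=> [V1 [H1 [n1 [f1 [V2 [H2 [n2 [f2 [[[P1 jn1 e1] _] [[P2 jn2 e2] _]]]]]]]]]].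
move=> ef ->.
move=> [V3 [H3 [n3 [f3 [V4 [H4 [n4 [f4 [[[P3 jn3 e3] _] [[P4 jn4 e4] _]]]]]]]]]].
move=> eg ->.
pose N := maxn (maxn n1 n2) (maxn n3 n4).
pose G i T := stopped n1 H1 i T - stopped n2 H2 i T
  - (stopped n3 H3 i T - stopped n4 H4 i T).
have le1 : (j <= n1 <= N)%N by rewrite jn1 /N !leq_max leqnn.
have le2 : (j <= n2 <= N)%N by rewrite jn2 /N !leq_max leqnn orbT.
have le3 : (j <= n3 <= N)%N by rewrite jn3 /N !leq_max leqnn !orbT.
have le4 : (j <= n4 <= N)%N by rewrite jn4 /N !leq_max leqnn !orbT.
have naS n H : PF S j H -> nonanticipative TS S j (stopped n H).
  move=> PH i T U ji nT nU TU; rewrite /stopped.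
  by rewrite (pf_nonanticipative pf SS PH ji nT nU TU).
have naG : nonanticipative TS S j G.
  move=> i T U ji nT nU TU; rewrite /G.
  by rewrite (naS n1 _ P1 i T U)// (naS n2 _ P2 i T U)//
     (naS n3 _ P3 i T U)// (naS n4 _ P4 i T U).
apply/eqP; rewrite -subr_eq0; apply/eqP.
have jN : (j <= N)%N by case/andP: le1 => a b; exact: leq_trans a b.
apply: (zero_wealth neu SS naG jN) => T nT.
have := ef T nT; rewrite eg// e1// e2// e3// e4//.
rewrite -(wealth_stopped V1 H1 T le1) -(wealth_stopped V2 H2 T le2).
rewrite -(wealth_stopped V3 H3 T le3) -(wealth_stopped V4 H4 T le4).
rewrite /wealth /G.
under [in X in _ -> X]eq_bigr do rewrite !mulrBl.
rewrite !sumrB; lra.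
Qed.

Lemma price_diffE S j f V1 H1 n1 f1 V2 H2 n2 f2 : portfolio_sets TS PF ->
  locally_neutral TS -> TS S ->
  represents TS PF S j V1 H1 n1 f1 -> (forall T, node TS S j T -> 0 <= f1 T) ->
  represents TS PF S j V2 H2 n2 f2 -> (forall T, node TS S j T -> 0 <= f2 T) ->
  (forall T, node TS S j T -> f T = f1 T - f2 T) ->
  price TS PF S j f = V1 - V2.
Proof.
move=> pf neu SS r1 p1 r2 p2 ef.
have Pv : price_values TS PF S j f (V1 - V2).
  by exists V1, H1, n1, f1, V2, H2, n2, f2.
by rewrite /price; case: xgetP => [v _ /price_values_unique|/(_ _ Pv)//]; apply.
Qed.

Lemma price_posE S j f V H n : portfolio_sets TS PF ->
  locally_neutral TS -> TS S ->
  represents TS PF S j V H n f -> (forall T, node TS S j T -> 0 <= f T) ->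
  price TS PF S j f = V.
Proof.
move=> pf neu SS r p; rewrite -[RHS]subr0.
apply: (@price_diffE S j f V H n f 0 (fun _ _ => 0) j (fun _ => 0)) => //.
- split=> //; first by apply: (pf_const (c := fun=> 0) pf) => // i _; apply: Or32.
  by move=> T _; rewrite /wealth big_geq// addr0.
- by move=> T _; rewrite subr0.
Qed.

End WellDefined.

(* Main.v *)
Require Import Defs.
From mathcomp Require Import all_boot all_order all_algebra.
From mathcomp Require Import all_classical all_reals all_analysis.
From mathcomp Require Import lra.

(** Suppose that the price of [f] exceeds the sum of the prices of the [f_m].
    The deficit, price of [f] minus total price of the [f_m], can be carried
    along a path of nodes: at each node there is a next move which keeps all
    but an arbitrarily small part of it. In the limit of the path, [f] still
    exceeds the sum of the [f_m] by a positive amount [d].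

    To make one move, the infinitely many portfolios are merged into a single
    position ([aggregate_move]). At an up-down node this is possible because
    every [f_m] has non-negative wealth at all intermediate times
    ([wealth_ge0]), hence after a fixed up move and after a fixed down move; so
    the position of [f_m] is at most a constant times its current wealth
    ([position_bound]), and the positions are absolutely summable because the
    wealths are summable. Local 0-neutrality then provides a move on which the
    merged position hardly gains. At a flat node or an arbitrage node of type I
    the positions need not be summable, but the price may stay where it is, and
    then no wealth changes. Halving the loss allowed at each step gives the
    path ([persistent_deficit]).

    The limit of the path may lie outside the trajectory set, so
    [f <= \sum f_m] cannot be evaluated there. The reversed Fatou property,
    applied to [- f] and the [f_m], closes this gap. It yields trajectories [Q n]
    of the node with the same limit. On them [- f + \sum f_m >= 0], so the
    upper limit of these sums is non-negative. Each function
    is decided by finitely many coordinates, so along [Q n] it is eventually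
    constant, with the value found along the path; the sum of these values
    would be non-negative, whereas it is at most [- d]. *)

Set Implicit Arguments.
Unset Strict Implicit.
Unset Printing Implicit Defensive.

Import Order.TTheory GRing.Theory Num.Theory.
Import numFieldNormedType.Exports.

Local Open Scope classical_set_scope.
Local Open Scope ring_scope.

(** * Series of real numbers *)

Section Series.
Context (R : realType).

Lemma cvg_series_bounded (w : nat -> R) (A : R) :
  (forall m, 0 <= w m) -> (forall M, series w M <= A) -> cvgn (series w).
Proof.
move=> w0 wA; apply: nondecreasing_is_cvgn.
  by apply/nondecreasing_seqP => n; rewrite seriesSr lerDl.
by exists A => _ [n _ <-].
Qed.

Lemma series_le_limn (w : nat -> R) M :
  (forall m, 0 <= w m) -> cvgn (series w) -> series w M <= limn (series w).
Proof.
move=> w0 cw; apply: nondecreasing_cvgn_le => //.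
by apply/nondecreasing_seqP => n; rewrite seriesSr lerDl.
Qed.

Lemma nneseries_le (u : nat -> R) (a : R) :
  (forall m, (1 <= m)%N -> 0 <= u m) ->
  (forall M, \sum_(1 <= m < M) u m <= a) ->
  (\sum_(1 <= m <oo) (u m)%:E <= a%:E)%E.
Proof.
move=> u0 ua; apply: lime_le.
  by apply: is_cvg_nneseries => m m1 _; rewrite lee_fin u0.
by apply: nearW => M; rewrite sumEFin lee_fin.
Qed.

(** The first term is exempt from the sign condition because it will be a value
    of the signed function [- f]. *)
Lemma nneseries_first (u : nat -> R) :
  (forall m, (1 <= m)%N -> 0 <= u m) ->
  (\sum_(0 <= m <oo) (u m)%:E = (u 0%N)%:E + \sum_(1 <= m <oo) (u m)%:E)%E.
Proof.
move=> u0; apply: cvg_lim => //.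
have c : cvgn (fun n => \sum_(1 <= m < n) (u m)%:E)%E.
  by apply: is_cvg_nneseries => m m1 _; rewrite lee_fin u0.
have : ((u 0%N)%:E + \sum_(1 <= m < n) (u m)%:E)%E @[n --> \oo] -->
    ((u 0%N)%:E + \sum_(1 <= m <oo) (u m)%:E)%E.
  by apply: cvgeD; [rewrite fin_num_adde_defr | exact: cvg_cst | exact: c].
apply: cvg_trans; apply: near_eq_cvg; near=> n.
by rewrite [in RHS]big_ltn//; near: n; exact: nbhs_infty_gt.
Unshelve. all: by end_near. Qed.

Lemma limn_esup_ge0 (u : nat -> \bar R) :
  (forall n, 0 <= u n)%E -> (0 <= limn_esup u)%E.
Proof.
move=> u0; rewrite limn_esup_lim; apply: lime_ge; first exact: is_cvg_esups.
apply: nearW => n; apply: le_trans (u0 n) _.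
by apply: ereal_sup_ubound; exists n => //=.
Qed.

End Series.

(** * Wealth before maturity *)

Section Wealth.
Context (R : realType) (TS : set (nat -> R)).

Lemma wealth_start j (V : R) H T : wealth j V H j T = V.
Proof. by rewrite /wealth big_geq// addr0. Qed.

Lemma wealthS j V (H : nat -> (nat -> R) -> R) k T : (j <= k)%N ->
  wealth j V H k.+1 T = wealth j V H k T + H k T * (T k.+1 - T k).
Proof. by move=> jk; rewrite /wealth big_nat_recr//= addrA. Qed.

Lemma wealth_agree S j V (H : nat -> (nat -> R) -> R) n T U :
  nonanticipative TS S j H -> node TS S j T -> node TS S j U ->
  (forall i, (i <= n)%N -> T i = U i) -> wealth j V H n T = wealth j V H n U.
Proof.
move=> naH nT nU TU; congr (_ + _); apply: eq_big_nat => i /andP[ji iltn].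
rewrite (naH i T U)// ?TU// ?(ltnW iltn)// => k /andP[_ ki].
by rewrite TU// (leq_trans ki)// ltnW.
Qed.

Lemma nonanticipative_stopped S j n H : nonanticipative TS S j H ->
  nonanticipative TS S j (@stopped R n H).
Proof.
by move=> naH i T U ji nT nU TU; rewrite /stopped (naH i T U ji nT nU TU).
Qed.

(** From a node at time [k], local 0-neutrality lets the future gains up to
    time [n] be at most [e]; a wealth below [- e] at time [k] would then leave
    a negative wealth at time [n]. *)
Lemma wealth_ge0 S j V H n k T : locally_neutral TS ->
  nonanticipative TS S j H -> (j <= k <= n)%N ->
  (forall U, node TS S j U -> 0 <= wealth j V H n U) ->
  node TS S j T -> 0 <= wealth j V H k T.
Proof.
move=> neu naH /andP[jk kn] w0 nT; apply/ler_addgt0Pr => e e0.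
have naT : nonanticipative TS T k H.
  move=> i U U' ki nU nU' UU'; apply: (naH i) => //.
  - exact: leq_trans ki.
  - exact: node_sub jk nT nU.
  - exact: node_sub jk nT nU'.
  move=> l /andP[jl li]; have [kl|lk] := leqP k l; first by apply: UU'; rewrite kl.
  by rewrite nU.2 ?nU'.2// ltnW.
have [U nU Ue] := small_gain neu nT.1 naT kn e0.
have nU' := node_sub jk nT nU.
apply: le_trans (w0 U nU') _; rewrite /wealth (big_cat_nat jk kn)/= addrA.
rewrite lerD// -/(wealth j V H k U) (wealth_agree V naH nU' nT) ?lexx//.
by move=> i ik; rewrite nU.2.
Qed.

End Wealth.

(** * One move at a node *)

Section Step.
Context (R : realType) (TS : set (nat -> R)).

(** The alternative behind the construction of the path: either nothing needs
    to change, or moves of both signs control all positions. An arbitrage node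
    of type II allows neither. *)
Lemma zero_move_or_up_down T k : TS T ->
  arbitrage_free_node TS T k \/ arbitrage_node_typeI TS T k ->
  (exists2 U, node TS T k U & U k.+1 = T k) \/
  (exists U U', [/\ node TS T k U, node TS T k U',
     0 < U k.+1 - T k & U' k.+1 - T k < 0]).
Proof.
move=> TT [[[up dn]|[s0 i0]]|[_ [U [nU U0]]]]; last by left; exists U.
  right; have [_ [U nU <-]] := ereal_sup_gt up; rewrite lte_fin => Up.
  have [_ [U' nU' <-]] := ereal_inf_lt dn; rewrite lte_fin => Dn.
  by exists U, U'.
have nT : node TS T k T by [].
have mT : moves TS T k (T k.+1 - T k)%:E by exists T.
have := ereal_sup_ubound mT; have := ereal_inf_lbound mT.
rewrite s0 i0 !lee_fin => ge0 le0.
by left; exists T => //; apply/eqP; rewrite -subr_eq0 eq_le le0.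
Qed.

(** A down move bounds a long position by the current wealth, an up move a
    short one. *)
Lemma position_bound (w h u d : R) : 0 <= w -> 0 < u -> d < 0 ->
  0 <= w + h * u -> 0 <= w + h * d -> `|h| <= (u^-1 + (- d)^-1) * w.
Proof.
move=> w0 u0 d0 wu wd.
have d0' : 0 < - d by rewrite oppr_gt0.
have hw : - h <= u^-1 * w by rewrite mulrC ler_pdivlMr//; lra.
have hw' : h <= (- d)^-1 * w by rewrite mulrC ler_pdivlMr//; lra.
have iu : 0 <= u^-1 * w by rewrite mulr_ge0// invr_ge0 ltW.
have id : 0 <= (- d)^-1 * w by rewrite mulr_ge0// invr_ge0 ltW.
by rewrite mulrDl ler_norml; apply/andP; split; lra.
Qed.

(** Here [w m] and [h m] are the current wealth and position of the [m]-th
    superhedging portfolio, [a] and [h0] those of the hedged claim, and [c] is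
    the deficit. Stating the deficit through all partial sums avoids the sum of
    the positions, which may diverge at nodes without moves of both signs. *)
Lemma aggregate_move T k (w h : nat -> R) (a h0 c e : R) :
  TS T -> neutral_node TS T k ->
  arbitrage_free_node TS T k \/ arbitrage_node_typeI TS T k ->
  0 < e -> (forall m, 0 <= w m) ->
  (forall m U, node TS T k U -> 0 <= w m + h m * (U k.+1 - T k)) ->
  (forall M, series w M + c <= a) ->
  exists2 U, node TS T k U & forall M,
    \sum_(0 <= m < M) (w m + h m * (U k.+1 - T k)) + (c - e) <=
    a + h0 * (U k.+1 - T k).
Proof.
move=> TT neu tp e0 w0 wh0 wa.
have cw : cvgn (series w).
  by apply: (@cvg_series_bounded _ _ (a - c)) => // M; rewrite lerBrDr.
have [[U nU U0]|[U [U' [nU nU' up dn]]]] := zero_move_or_up_down TT tp.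
  exists U => // M; rewrite U0 subrr mulr0 addr0.
  under eq_bigr do rewrite mulr0 addr0.
  have := wa M; rewrite /series/=; lra.
have ch : cvgn (series h).
  apply: normed_cvg; apply: (@series_le_cvg _ _
    ((((U k.+1 - T k)^-1 + (- (U' k.+1 - T k))^-1) *: w))).
  - by move=> n; exact: normr_ge0.
  - move=> n; apply: mulr_ge0 => //.
    by rewrite addr_ge0// invr_ge0 ?oppr_ge0 ltW.
  - by move=> n; apply: position_bound => //; apply: wh0.
  - exact: is_cvg_seriesZ.
(* The merged position, superhedge minus claim, gains at most e. *)
have [X nX Xe] := small_move (limn (series h) - h0) neu e0.
exists X => // M; set d := X k.+1 - T k in Xe *.
pose v m := w m + h m * d.
have v0 m : 0 <= v m by exact: wh0.
have sv : series v = series w + d *: series h.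
  apply/funext => n; transitivity (series w n + d * series h n) => //.
  by rewrite /v /series/= big_split/= -mulr_suml (mulrC _ d).
have lv : series v @ \oo --> limn (series w) + d *: limn (series h).
  by rewrite sv; apply: cvgD => //; apply: cvgZr.
have cv : cvgn (series v) by apply/cvg_ex; eexists; exact: lv.
have := series_le_limn M v0 cv; rewrite (cvg_lim _ lv)// /series/= => vM.
have wl : limn (series w) <= a - c.
  by apply: limr_le => //; apply: nearW => n; rewrite lerBrDr.
rewrite /GRing.scale/= in vM.
have -> : \sum_(0 <= m < M) (w m + h m * d) = \sum_(0 <= m < M) v m by [].
lra.
Qed.

End Step.

(** * A path with a persistent deficit *)

Section Path.
Context (R : realType) (TS : set (nat -> R)).

(** The path consists of the nodes [(P n, j + n)]; later steps keep only the
    coordinates of [P n] up to [j + n]. The deficit starts at [2 d] and is at least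
    [d + d / 2 ^ n] at step [n]. *)
Lemma persistent_deficit S j (V0 d : R) H0 (V : nat -> R)
    (H : nat -> nat -> (nat -> R) -> R) :
  (forall T k, TS T ->
     arbitrage_free_node TS T k \/ arbitrage_node_typeI TS T k) ->
  locally_neutral TS -> TS S -> 0 < d ->
  nonanticipative TS S j H0 ->
  (forall m, nonanticipative TS S j (H m)) ->
  (forall m k T, (j <= k)%N -> node TS S j T ->
     0 <= wealth j (V m) (H m) k T) ->
  (forall M, series V M + d *+ 2 <= V0) ->
  exists P : nat -> nat -> R,
    [/\ forall n, node TS S j (P n),
        forall n i, (i <= j + n)%N -> P n i = P n.+1 i &
        forall n M, \sum_(0 <= m < M) wealth j (V m) (H m) (j + n) (P n) + d <=
          wealth j V0 H0 (j + n) (P n)].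
Proof.
move=> tp neu SS d0 naH0 naH w0 HV.
pose good n T := node TS S j T /\ forall M,
  \sum_(0 <= m < M) wealth j (V m) (H m) (j + n) T + (d + d / 2 ^+ n) <=
  wealth j V0 H0 (j + n) T.
have step (nT : nat * (nat -> R)) : exists U, good nT.1 nT.2 ->
    node TS nT.2 (j + nT.1)%N U /\ good nT.1.+1 U.
  case: nT => n T /=; have [[nT gT]|ng] := pselect (good n T); last by exists T.
  have e0 : 0 < d / 2 ^+ n.+1 by rewrite divr_gt0// exprn_gt0.
  have sub U : node TS T (j + n)%N U -> node TS S j U.
    by apply: node_sub nT; rewrite leq_addr.
  (* All trajectories of the node share the wealth and position at time j + n. *)
  have wS V' H' U : nonanticipative TS S j H' -> node TS T (j + n)%N U ->
      wealth j V' H' (j + n).+1 U =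
      wealth j V' H' (j + n) T + H' (j + n)%N T * (U (j + n).+1 - T (j + n)%N).
    move=> naH' nU; rewrite wealthS ?leq_addr// (nU.2 (j + n)%N)//.
    rewrite (wealth_agree V' naH' (sub U nU) nT nU.2).
    rewrite (naH' _ U T (leq_addr n j) (sub U nU) nT)//.
    by move=> k /andP[_]; exact: nU.2.
  have [U nU HU] := @aggregate_move R TS T (j + n)
    (fun m => wealth j (V m) (H m) (j + n) T) (fun m => H m (j + n)%N T)
    (wealth j V0 H0 (j + n) T) (H0 (j + n)%N T) (d + d / 2 ^+ n) _
    nT.1 (neu T (j + n)%N nT.1) (tp T (j + n)%N nT.1) e0
    (fun m => w0 m _ T (leq_addr n j) nT)
    (fun m U nU => eq_ind _ (fun x => 0 <= x)
       (w0 m (j + n).+1 U (leqW (leq_addr n j)) (sub U nU)) _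
       (wS (V m) (H m) U (naH m) nU)) gT.
  exists U => _; split=> //; split; first exact: sub.
  move=> M; rewrite addnS wS//.
  under eq_bigr do rewrite wS//.
  have -> : d + d / 2 ^+ n.+1 = d + d / 2 ^+ n - d / 2 ^+ n.+1.
    rewrite -addrA; congr (_ + _); apply/eqP; rewrite eq_sym subr_eq -mulr2n.
    by rewrite -mulrnAl exprS invfM mulrA -[d *+ 2]mulr_natr mulfK.
  exact: HU.
have [nxt nxtP] := choice step.
pose P := fix P n := if n is n'.+1 then nxt (n', P n') else S.
have gP n : good n (P n).
  elim: n => [|n IH]; last by have [] := nxtP (n, P n) IH.
  split=> [|M]; first by [].
  rewrite addn0 expr0 divr1 -mulr2n wealth_start.
  by under eq_bigr do rewrite wealth_start; exact: HV.
exists P; split=> [n|n i ij|n M]; first by have [] := gP n.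
  by have [[_ /= ->]] := nxtP (n, P n) (gP n).
apply: le_trans ((gP n).2 M).
by rewrite lerD2l lerDl divr_ge0 ?exprn_ge0// ltW.
Qed.

End Path.

(** * The limit of the path *)

Theorem theorem1 (R : realType) (s0 : R) (TS : set (nat -> R))
    (PF : (nat -> R) -> nat -> set (nat -> (nat -> R) -> R))
    (hTS : is_trajectory_set s0 TS)
    (hPF : portfolio_sets TS PF)
    (hRFP : forall (S : nat -> R) (j : nat), TS S -> reversed_fatou TS PF S j)
    (hnodes : forall (S : nat -> R) (j : nat), TS S ->
       arbitrage_free_node TS S j \/ arbitrage_node_typeI TS S j) :
  forall (S : nat -> R) (j : nat), TS S -> property_L TS PF S j.
Proof.
move=> S j SS f fm [f1 [f2 [[[V1 [H1 [n1 r1]]] p1] [[V2 [H2 [n2 r2]]] p2] ef]]].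
move=> pfm le_f.
have neu : locally_neutral TS.
  move=> T k TT.
  by case: (hnodes T k TT); [exact: neutral_arbitrage_free|exact: neutral_typeI].
have data m : exists VHN : R * (nat -> (nat -> R) -> R) * nat, (1 <= m)%N ->
    represents TS PF S j VHN.1.1 VHN.1.2 VHN.2 (fm m) /\
    forall T, node TS S j T -> 0 <= fm m T.
  have [m1|_] := leqP 1 m; last by exists (0, fun=> fun=> 0, 0%N).
  by have [[V [H [N r]]] p] := pfm m m1; exists (V, H, N).
have {data pfm}[VHN VHNP] := choice data.
pose V m := (VHN m).1.1; pose H m := (VHN m).1.2; pose N m := (VHN m).2.
have rm m : (1 <= m)%N -> represents TS PF S j (V m) (H m) (N m) (fm m).
  by case/VHNP.
have fm0 m T : (1 <= m)%N -> node TS S j T -> 0 <= fm m T.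
  by case/VHNP=> _; exact.
rewrite (price_diffE hPF neu SS r1 p1 r2 p2 ef).
have -> : (\sum_(1 <= m <oo) (price TS PF S j (fm m))%:E =
    \sum_(1 <= m <oo) (V m)%:E)%E.
  apply: congr_lim; apply/funext => n; apply: eq_big_nat => m /andP[m1 _].
  by rewrite (price_posE hPF neu SS (rm m m1))// => T; exact: fm0.
(* Stopped portfolios keep their terminal wealth, so that all wealths can be
   compared at a common time. *)
pose n0 := maxn n1 n2.
pose H0 i T := stopped n1 H1 i T - stopped n2 H2 i T.
case: (r1) (r2) => PH1 jn1 e1 [PH2 jn2 e2].
have naS n K : PF S j K -> nonanticipative TS S j (stopped n K).
  by move=> PK; apply: nonanticipative_stopped; exact: pf_nonanticipative PK.
have naH0 : nonanticipative TS S j H0.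
  by move=> i T U ji nT nU TU; rewrite /H0 (naS n1 _ PH1 i T U)// (naS n2 _ PH2 i T U).
have f_wealth k T : (n0 <= k)%N -> node TS S j T ->
    f T = wealth j (V1 - V2) H0 k T.
  rewrite /n0 geq_max => /andP[n1k n2k] nT; rewrite ef// e1// e2//.
  rewrite -(@wealth_stopped _ j n1 k) ?jn1// -(@wealth_stopped _ j n2 k) ?jn2//.
  rewrite /wealth /H0; under [in RHS]eq_bigr do rewrite mulrBl.
  by rewrite sumrB; lra.
pose G m := stopped (N m) (H m).
have naG m : (1 <= m)%N -> nonanticipative TS S j (G m).
  by case/rm=> PH _ _; exact: naS.
have fm_wealth m k T : (1 <= m)%N -> (N m <= k)%N -> node TS S j T ->
    fm m T = wealth j (V m) (G m) k T.
  by move=> m1 Nk nT; have [_ jN e] := rm m m1; rewrite e// wealth_stopped ?jN.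
have wG m k T : (1 <= m)%N -> (j <= k)%N -> node TS S j T ->
    0 <= wealth j (V m) (G m) k T.
  move=> m1 jk; apply: (@wealth_ge0 _ _ _ _ _ _ (maxn k (N m))) => //.
  - exact: naG.
  - by rewrite jk leq_maxl.
  - by move=> U nU; rewrite -fm_wealth ?leq_maxr// fm0.
have nS : node TS S j S by [].
have V_ge0 m : (1 <= m)%N -> 0 <= V m.
  move=> m1; have := wG m j S m1 (leqnn j) nS.
  by rewrite wealth_start.
rewrite leNgt; apply/negP => ltV.
have sumV_ge0 : (0 <= \sum_(1 <= m <oo) (V m)%:E)%E.
  by apply: nneseries_ge0 => m m1 _; rewrite lee_fin V_ge0.
have sumV_lty := lt_trans ltV (ltry (V1 - V2)).
have sumV_fin : (\sum_(1 <= m <oo) (V m)%:E)%E \is a fin_num.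
  by rewrite ge0_fin_numE.
pose v := fine (\sum_(1 <= m <oo) (V m)%:E)%E.
have vE : (\sum_(1 <= m <oo) (V m)%:E)%E = v%:E by rewrite fineK.
have v_lt : v < V1 - V2 by move: ltV; rewrite vE lte_fin.
pose d := (V1 - V2 - v) / 2.
have d0 : 0 < d by rewrite divr_gt0// subr_gt0.
have V_le M : series (fun m => V m.+1) M + d *+ 2 <= V1 - V2.
  rewrite /d -mulr_natr divfK// addrCA -lerBrDl subrr subr_le0.
  rewrite /series/= -(big_add1 _ _ 0 M.+1 xpredT) -lee_fin -vE -sumEFin.
  by apply: nneseries_lim_ge => m m1 _; rewrite lee_fin V_ge0.
have [P [nP PS Pd]] := persistent_deficit hnodes neu SS d0 naH0
  (fun m => naG m.+1 isT) (fun m k T => wG m.+1 k T isT) V_le.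
pose Sbar i := P i i.
have P_bar n i : (i <= n)%N -> P n i = Sbar i.
  move=> /subnK <-; elim: (n - i)%N => [//|k IH].
  by rewrite addSn -PS// addnA leq_addl.
pose g m := if m is 0%N then fun T => - f T else fm m.
have [||//||Q [[nQ QS QSbar] gQ]] := hRFP S j SS g V H N Sbar.
- exists f2, f1; split=> [||T nT]; first by split=> //; exists V2, H2, n2.
    by split=> //; exists V1, H1, n1.
  by rewrite /g ef// opprB.
- by move=> [//|m] m1; split; [exact: rm|move=> T; exact: fm0].
- by exists P; split=> // n i ni; apply: PS; rewrite (leq_trans ni) ?leq_addl.
have Q_bar n i : (i <= n)%N -> Q n i = Sbar i.
  move=> /subnK <-; elim: (n - i)%N => [|k IH]; first by rewrite add0n QSbar.
  by rewrite addSn -QS// leq_addl.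
pose K m := if m is 0%N then n0 else N m.
have g_wealth m k T U : (K m <= k)%N -> node TS S j T -> node TS S j U ->
    (forall i, (i <= k)%N -> T i = U i) -> g m T = g m U.
  case: m => [|m] Kk nT nU TU /=.
    by rewrite !(f_wealth k)// (wealth_agree _ naH0 nT nU TU).
  by rewrite !(fm_wealth m.+1 k)// (wealth_agree _ (naG m.+1 isT) nT nU TU).
pose F m := g m (P (K m)).
have gP m n : (K m <= n)%N -> g m (P n) = F m.
  move=> Kn; apply: (g_wealth m (K m)) => // i iK.
  by rewrite !P_bar// (leq_trans iK).
have gQF m n : (K m <= n)%N -> g m (Q n) = F m.
  move=> Kn; apply: (g_wealth m (K m)) => // i iK.
  by rewrite Q_bar ?P_bar// (leq_trans iK).
have F_ge0 m : (1 <= m)%N -> 0 <= F m by case: m => // m _; exact: fm0.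
have F_le M : \sum_(1 <= m < M) F m <= - F 0%N - d.
  (* L is a step at which the claim and the first M superhedges are all decided. *)
  pose L := (n0 + \sum_(m < M) N m)%N.
  have N_le m : (m < M)%N -> (N m <= L)%N.
    by move=> mM; rewrite /L (bigD1 (Ordinal mM))//= addnCA leq_addr.
  have -> : - F 0%N = wealth j (V1 - V2) H0 (j + L) (P L).
    rewrite -(gP _ L) ?leq_addr// opprK; apply: f_wealth => //.
    by rewrite (leq_trans _ (leq_addl _ _))// leq_addr.
  rewrite lerBrDr; apply: le_trans (Pd L M.-1); rewrite lerD2r.
  rewrite big_add1 le_eqVlt; apply/orP; left; apply/eqP.
  apply: eq_big_nat => m /andP[_ mM].
  have mM' : (m.+1 < M)%N by case: (M) mM.
  rewrite -(gP _ L) ?N_le//; apply: fm_wealth => //.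
  by rewrite (leq_trans (N_le _ mM'))// leq_addl.
have limF m : limn_esup (fun n => (g m (Q n))%:E) = (F m)%:E.
  apply: (@cvg_limn_einf_sup _ _ _ _).2; apply: cvg_near_cst.
  by near=> n; rewrite gQF//; near: n; exact: nbhs_infty_ge.
have : (0 <= \sum_(0 <= m <oo) (F m)%:E)%E.
  have := gQ; under [X in (_ <= X)%E]eq_eseriesr do rewrite limF.
  apply: le_trans; apply: limn_esup_ge0 => n.
  rewrite nneseries_first => [|[//|m] m1]; last exact: fm0.
  have -> : (\sum_(1 <= m <oo) (g m (Q n))%:E = \sum_(1 <= m <oo) (fm m (Q n))%:E)%E.
    by apply: congr_lim; apply/funext => M; apply: eq_big_nat => -[].
  by rewrite /g EFinN addeC sube_ge0// le_f.
rewrite nneseries_first// leNgt => /negP; apply.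
apply: (@le_lt_trans _ _ ((F 0%N)%:E + (- F 0%N - d)%:E)%E).
  by rewrite leeD2l// nneseries_le.
by rewrite -EFinD lte_fin; lra.
Unshelve. all: by end_near. Qed.
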